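(* Suppose $G$ is a graph of order $p$ and size $q$ with exactly one vertex of maximum degree $\Delta\ge 3$, that this vertex is not adjacent to any pendant vertex, and that all other vertices of $G$ have degree at most $m<\Delta$. Moreover, suppose $G$ has $k\ge\Delta\ge 2$ pendant edges and that $$\Delta(\Delta+1)>\max\{\,m[2(p+q)-m+1],\ 4(p+q)-2\,\}.$$ If $G$ admits a local total antimagic labeling, then $\chi_{lt}(G)\ge k+2$.
   Context: All graphs are finite, simple and loopless, of order $p=|V|\ge 3$ and size $q=|E|\ge 2$, with no isolated vertex and no $K_2$ component (graphs may be disconnected). A pendant vertex is a vertex of degree 1; a pendant edge is an edge incident to a pendant vertex. A local total antimagic labeling of $G=(V,E)$ is a bijection $f:V\cup E\to\{1,\dots,p+q\}$ such that, with weights $w_f(u)=\sum f(e)$ over all edges $e$ incident to $u$ for $u\in V$ (the label of $u$ itself is not included) and $w_f(uv)=f(u)+f(v)$ for $uv\in E$, one has: adjacent vertices have distinct weights, adjacent edges have distinct weights, and every vertex has a weight distinct from that of each of its incident edges. $\chi_{lt}(G)$ is the minimum, over all local total antimagic labelings $f$ of $G$, of the number of distinct values among all the vertex and edge weights. *)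

(* Defs.v *)
From HB Require Import structures.
From mathcomp Require Import all_boot.

Set Implicit Arguments.
Unset Strict Implicit.
Unset Printing Implicit Defensive.

Record sgraph := SGraph {
  svertex :> finType;
  adj : rel svertex;
  adj_sym : symmetric adj;
  adj_irrefl : irreflexive adj }.

Section Graph.
Variable G : sgraph.
Implicit Types (u v x y : G).

Definition edges : {set {set G}} :=
  [set A : {set G} | [exists x, exists y, adj x y && (A == [set x; y])]].

Definition edge : finType := {A : {set G} | A \in edges}.

Definition gorder : nat := #|G|.
Definition gsize : nat := #|edges|.

Definition degree u : nat := #|[set v | adj u v]|.
Definition max_degree : nat := \max_(u : G) degree u.

Definition isolated u : bool := degree u == 0.
Definition pendant u : bool := degree u == 1.
Definition pendant_edges : {set {set G}} :=
  [set A in edges | [exists u in A, pendant u]].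

Definition component u : {set G} := [set v | connect (@adj G) u v].
Definition has_K2_component : bool :=
  [exists x, exists y, adj x y && (component x == [set x; y])].

(* A vertex or edge z carries the label (f z).+1, so that the labels range over
   1, ..., p + q while the values of f range over 0, ..., p + q - 1. *)
Definition labeling : finType :=
  {ffun (G + edge)%type -> 'I_(gorder + gsize)}.

Definition label (f : labeling) (z : G + edge) : nat := (f z).+1.

Definition vweight (f : labeling) u : nat :=
  \sum_(e : edge | u \in val e) label f (inr e).

Definition eweight (f : labeling) (e : edge) : nat :=
  \sum_(u in val e) label f (inl u).

Definition weight (f : labeling) (z : G + edge) : nat :=
  match z with inl u => vweight f u | inr e => eweight f e end.

Definition adjacent_edges (e1 e2 : edge) : bool :=
  (e1 != e2) && (val e1 :&: val e2 != set0).

Definition local_total_antimagic (f : labeling) : bool :=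
  [&& injectiveb f, [forall i, exists z, f z == i],
      [forall u, forall v, adj u v ==> (vweight f u != vweight f v)],
      [forall e1, forall e2,
         adjacent_edges e1 e2 ==> (eweight f e1 != eweight f e2)]
    & [forall u : G, forall e : edge,
         (u \in val e) ==> (vweight f u != eweight f e)]].

Definition num_weights (f : labeling) : nat :=
  size (undup (codom (weight f))).

Definition admits_lta : Prop := exists f, local_total_antimagic f.

Definition lta_attains (n : nat) : bool :=
  [exists f, local_total_antimagic f && (num_weights f == n)].

Lemma admits_lta_attains : admits_lta -> exists n, lta_attains n.
Proof.
by case=> f hf; exists (num_weights f); apply/existsP; exists f; rewrite hf eqxx.
Qed.

Definition chi_lt (h : admits_lta) : nat := ex_minn (admits_lta_attains h).

End Graph.

(* Main.v *)
(** Let [N = p + q].  The weight of a pendant vertex is the label of its only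
    edge, so the [k] pendant edges give [k] distinct weights, all at most [N].
    If [e] is the pendant edge with the largest label, its non-pendant end [y]
    has degree at least 2, so its weight exceeds all of these.  Finally [c]
    has weight at least [1 + ... + Delta], which by hypothesis exceeds [N] and
    also the sum [N + (N - 1) + ... + (N - m + 1)] bounding the weight of every
    other vertex; and [y != c] because [c] has no pendant neighbour. *)

Require Import Defs.
From mathcomp Require Import all_boot zify.

Lemma card_le_of_inj_lt (T : finType) (g : T -> nat) (A : {set T}) n :
  {in A &, injective g} -> {in A, forall x, g x < n} -> #|A| <= n.
Proof.
move=> g_inj g_lt; rewrite cardE -(size_map g) -[leqRHS](size_iota 0).
apply: uniq_leq_size => [|_ /mapP[x + ->]].
  by rewrite map_inj_in_uniq ?enum_uniq // => x y; rewrite !mem_enum; apply: g_inj.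
by rewrite mem_enum mem_iota /= => /g_lt.
Qed.

(** Induction on the size of [A], removing an element where [g] is largest. By pigeonhole its
    shifted value is at least [#|A|], so the sum dominates [1 + ... + #|A|]. *)
Lemma sum_inj_ge (T : finType) (g : T -> nat) (A : {set T}) :
  {in A &, injective g} -> #|A| * #|A|.+1 <= 2 * \sum_(x in A) (g x).+1.
Proof.
elim/ltn_ind: {A}#|A| {-2}A (erefl #|A|) => n IHn A cardA g_inj.
have [A0|[x0 Ax0]] := set_0Vmem A; first by rewrite A0 cards0.
case: (arg_maxnP g Ax0) => x Ax x_max.
have card_le : #|A| <= (g x).+1.
  by apply: (card_le_of_inj_lt _ g _ _ g_inj) => y /x_max; rewrite ltnS.
have cardD : #|A| = (#|A :\ x|).+1 by rewrite (cardsD1 x A) (Ax : x \in A).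
have ltD : #|A :\ x| < n by rewrite -cardA cardD.
have injD : {in A :\ x &, injective g}.
  by move=> y z /setD1P[_ Ay] /setD1P[_ Az]; apply: g_inj.
have := IHn _ ltD _ erefl injD.
rewrite (big_setD1 x Ax) /=; nia.
Qed.

(* Reflecting the labels, [i |-> N + 1 - i], turns the lower bound into this one. *)
Lemma sum_inj_le (T : finType) (N m : nat) (g : T -> 'I_N) (A : {set T}) :
    {in A &, injective g} -> #|A| <= m -> m <= N ->
  2 * \sum_(x in A) (g x).+1 <= m * (2 * N - m + 1).
Proof.
move=> g_inj Am mN.
have rev_inj : {in A &, injective (fun x => rev_ord (g x) : nat)}.
  by move=> x y Ax Ay /val_inj/rev_ord_inj/(g_inj _ _ Ax Ay).
have := sum_inj_ge _ _ _ rev_inj.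
have : \sum_(x in A) (g x).+1 + \sum_(x in A) (rev_ord (g x)).+1 = #|A| * N.+1.
  rewrite -big_split -sum_nat_const; apply: eq_bigr => x _ /=.
  have := ltn_ord (g x); lia.
(* The reflected bound gives [#|A| * (2 * N - #|A| + 1)]. Since [a * (2 * N - a + 1)] increases with
   [a] up to [N], [#|A|] may be replaced by [m]. *)
nia.
Qed.

Section Graph.
Variable G : sgraph.
Implicit Types (u v x y : G) (e : edge G) (f : labeling G).

Definition incident u : {set edge G} := [set e : edge G | u \in val e].

Lemma edgeP e : exists x y, adj x y /\ val e = [set x; y].
Proof.
by have := valP e; rewrite inE => /existsP[x /existsP[y /andP[xy /eqP]]]; exists x, y.
Qed.

Lemma adj_edge u v : adj u v -> exists e, val e = [set u; v].
Proof.
move=> uv; suff uvE : [set u; v] \in edges G by exists (exist _ [set u; v] uvE).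
by rewrite inE; apply/existsP; exists u; apply/existsP; exists v; rewrite uv eqxx.
Qed.

(** Incident edges and neighbours have the same image among the pairs [[set u; v]]. The map from
    neighbours is injective because a neighbour of [u] is never [u] itself. *)
Lemma card_incident u : #|incident u| = degree u.
Proof.
rewrite -(card_imset _ val_inj) /degree.
have inj2 : {in [set v | adj u v] &, injective (fun v => [set u; v])}.
  move=> v w; rewrite !inE => uv uw eq_vw.
  have := set22 u v; rewrite eq_vw => /set2P[vu|//].
  by rewrite vu adj_irrefl in uv.
rewrite -(card_in_imset inj2); apply: eq_card => A.
apply/imsetP/imsetP => [[e + ->]|[v + ->]]; rewrite inE.
  have [x [y [xy ->]]] := edgeP e.
  case/set2P=> ->; first by exists y; rewrite ?inE.
  by exists x; rewrite ?inE 1?adj_sym // setUC.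
by move=> uv; have [e e_uv] := adj_edge _ _ uv; exists e; rewrite ?inE ?e_uv ?set21.
Qed.

Lemma vweightE f u : vweight f u = \sum_(e in incident u) (f (inr e)).+1.
Proof. by apply: eq_bigl => e; rewrite inE. Qed.

Lemma vweight_pendant f u e :
  pendant u -> u \in val e -> vweight f u = label f (inr e).
Proof.
rewrite /pendant -card_incident => /cards1P[e' inc_u] ue.
have : e \in incident u by rewrite inE.
by rewrite vweightE inc_u => /set1P->; rewrite big_set1.
Qed.

(** A second edge at [u] adds a positive amount, since labels start at 1. *)
Lemma label_lt_vweight f u e :
  1 < degree u -> u \in val e -> label f (inr e) < vweight f u.
Proof.
rewrite -card_incident => inc_gt1 ue.
have ince : e \in incident u by rewrite inE.
have [e' De'] : exists e', e' \in incident u :\ e.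
  by apply/card_gt0P; move: inc_gt1; rewrite (cardsD1 e) ince.
by rewrite vweightE (big_setD1 e ince) (big_setD1 e' De') -[ltnLHS]addn0 ltn_add2l.
Qed.

Lemma label_edge_inj f : injective f -> injective (fun e => f (inr e)).
Proof. by move=> f_inj e e' /f_inj[]. Qed.

Lemma vweight_ge f u :
  injective f -> degree u * (degree u).+1 <= 2 * vweight f u.
Proof.
move=> /label_edge_inj f_inj; rewrite -card_incident vweightE.
by apply: (sum_inj_ge _ (fun e => f (inr e))) => e e' _ _ /val_inj/f_inj.
Qed.

Lemma vweight_le f u m :
    injective f -> degree u <= m -> m <= gorder G + gsize G ->
  2 * vweight f u <= m * (2 * (gorder G + gsize G) - m + 1).
Proof.
move=> /label_edge_inj f_inj um mN; rewrite vweightE.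
by apply: sum_inj_le; rewrite ?card_incident // => e e' _ _ /f_inj.
Qed.

Lemma adj_pendant u v w : pendant u -> adj u v -> adj u w -> w = v.
Proof.
move=> /cards1P[z nbr_u] uv uw.
have : v \in [set z] by rewrite -nbr_u inE.
have : w \in [set z] by rewrite -nbr_u inE.
by move=> /set1P-> /set1P->.
Qed.

(** Each end is the only neighbour of the other, so the pair is closed under adjacency and hence is
    a whole component. *)
Lemma adj_pendants_K2 x y :
  adj x y -> pendant x -> pendant y -> has_K2_component G.
Proof.
move=> xy px py; have yx : adj y x by rewrite adj_sym.
apply/existsP; exists x; apply/existsP; exists y; rewrite xy.
apply/eqP/setP => z; rewrite inE; apply/idP/idP; last first.
  by case/set2P=> ->; [exact: connect0 | exact: connect1].
have cl : closed (@adj G) (mem [set x; y]).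
  apply: (intro_closed (sym_connect_sym (@adj_sym G))) => u v uv.
  rewrite !inE => /orP[]/eqP u_eq; rewrite u_eq in uv.
    by rewrite (adj_pendant _ _ _ px xy uv) eqxx orbT.
  by rewrite (adj_pendant _ _ _ py yx uv) eqxx.
by move/(closed_connect cl) => <-; rewrite set21.
Qed.

Lemma pendant_edge_ends e :
    ~~ has_K2_component G -> val e \in pendant_edges G ->
  exists x y, [/\ adj x y, val e = [set x; y], pendant x & ~~ pendant y].
Proof.
move=> noK2; rewrite inE => /andP[_ /existsP[u /andP[]]].
have [x [y [xy ->]]] := edgeP e.
case/set2P=> -> pu; [exists x, y | exists y, x]; split=> //.
- by apply: contraNN noK2 => py; apply: (adj_pendants_K2 _ _ xy).
- by rewrite adj_sym.
- by rewrite setUC.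
- by apply: contraNN noK2 => px; apply: (adj_pendants_K2 _ _ xy).
Qed.

(** Labels are indexed by the subtype [edge G], whereas [pendant_edges] consists of bare vertex
    sets; this transfers the count [k] between the two. *)
Lemma card_pendant_edges :
  #|[set e : edge G | val e \in pendant_edges G]| = #|pendant_edges G|.
Proof.
rewrite -(card_imset _ val_inj); apply: eq_card => A.
apply/imsetP/idP => [[e + ->]|pA]; first by rewrite inE.
have eA : A \in edges G by move: pA; rewrite inE => /andP[].
by exists (exist _ A eA); rewrite // inE.
Qed.

Lemma size_le_num_weights f (s : seq nat) :
  uniq s -> {subset s <= codom (weight f)} -> size s <= num_weights f.
Proof. by move=> us sub; apply: uniq_leq_size => // n /sub; rewrite mem_undup. Qed.

End Graph.

Theorem theorem2p6 (G : sgraph) (p q Delta m k : nat) (c : G)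
    (hp : p = gorder G) (hq : q = gsize G)
    (hp3 : 3 <= p) (hq2 : 2 <= q)
    (hisol : forall u : G, ~~ isolated u)
    (hK2 : ~~ has_K2_component G)
    (hDelta : Delta = max_degree G) (hDelta3 : 3 <= Delta)
    (hc : degree c = Delta)
    (hc_unique : forall u : G, degree u = Delta -> u = c)
    (hc_pendant : forall u : G, pendant u -> ~~ adj c u)
    (hmDelta : m < Delta)
    (hm : forall u : G, u != c -> degree u <= m)
    (hk : k = #|pendant_edges G|)
    (hkDelta : Delta <= k) (hDelta2 : 2 <= Delta)
    (hbound : maxn (m * (2 * (p + q) - m + 1)) (4 * (p + q) - 2)
              < Delta * (Delta + 1))
    (hlta : admits_lta G) :
  k + 2 <= chi_lt hlta.
Proof.
rewrite /chi_lt; case: ex_minnP => n /existsP[f /andP[lta /eqP <-]] _.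
case/and5P: lta => /injectiveP f_inj _ _ _ _.
set N := gorder G + gsize G; rewrite hp hq -/N in hbound.
have lt_max := hbound; rewrite gtn_max in lt_max; case/andP: lt_max => lt_m lt_N.
(* The upper bound on weights needs enough labels to choose from:
   [m < Delta = degree c <= p <= N]. *)
have mN : m <= N.
  have : degree c <= gorder G by apply: max_card.
  rewrite /N; lia.
have w_c : Delta * Delta.+1 <= 2 * vweight f c by rewrite -hc; apply: vweight_ge.
have label_le z : label f z <= N := ltn_ord (f z).
(* From [4 * N - 2 < Delta * (Delta + 1) <= 2 * vweight f c], the weight of [c] is at least [2 * N],
   above every label. *)
have label_lt_c e : label f (inr e) < vweight f c.
  have := label_le (inr e); nia.
pose P := [set e : edge G | val e \in pendant_edges G].
have cardP : #|P| = k by rewrite hk -card_pendant_edges.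
have [e0 Pe0] : exists e, e \in P by apply/card_gt0P; lia.
case: (arg_maxnP (fun e => label f (inr e)) Pe0) => e Pe e_max.
have [x [y [xy e_xy px npy]]] : exists x y,
    [/\ adj x y, val e = [set x; y], pendant x & ~~ pendant y].
  by apply: pendant_edge_ends => //; have : e \in P := Pe; rewrite inE.
have yc : y != c.
  by apply: contraTneq xy => ->; rewrite adj_sym; apply: hc_pendant.
(* Twice the weight of [y] is at most [m * (2 * N - m + 1)], which is below
   [Delta * (Delta + 1)]. *)
have w_y : vweight f y < vweight f c.
  have := vweight_le _ f y m f_inj (hm y yc) mN; rewrite -/N; lia.
have lt_y : label f (inr e) < vweight f y.
  apply: label_lt_vweight; last by rewrite e_xy set22.
  by move: npy (hisol y); rewrite /pendant /isolated; lia.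
pose L := [seq label f (inr e') | e' <- enum P].
have -> : k + 2 = size [:: vweight f c, vweight f y & L].
  by rewrite /= size_map -cardE cardP addn2.
(* For distinctness, every label in [L] is at most that of [e], hence below the weight of [y], which
   is below that of [c]; within [L], distinct edges have distinct labels. *)
apply: size_le_num_weights => [|w].
  rewrite /= inE negb_or neq_ltn w_y orbT /=; apply/and3P; split.
  - by apply/mapP => -[e' _ w_eq]; have := label_lt_c e'; rewrite w_eq ltnn.
  - apply/mapP => -[e']; rewrite mem_enum => /e_max le_e w_eq.
    by move: lt_y; rewrite w_eq ltnNge (le_e : _ <= _).
  - rewrite map_inj_uniq ?enum_uniq // => e1 e2 [] /val_inj.
    exact: label_edge_inj.
rewrite !inE => /or3P[/eqP->|/eqP->|/mapP[e' + ->]].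
- exact: (codom_f (weight f) (inl c)).
- exact: (codom_f (weight f) (inl y)).
(* A label in [L] is attained as a weight at the pendant end of its edge. *)
rewrite mem_enum inE => pe'.
have [x' [y' [_ e'_eq px' _]]] := pendant_edge_ends _ _ hK2 pe'.
rewrite -(vweight_pendant _ f x' e' px') ?e'_eq ?set21 //.
exact: (codom_f (weight f) (inl x')).
Qed.
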